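(* For any multigraph $G$ on $n$ vertices, $P(G,m)-P_{DP}(G,m)=O(m^{n-1})$ as $m\to\infty$.
   Context: All graphs are finite, nonempty, loopless multigraphs. $P(G,m)$ is the number of proper colorings of $G$ with colors from $[m]$ (adjacent vertices get different colors). For $u,v\in V(G)$, $E_G(u,v)$ is the set of edges joining $u,v$ and $e_G(u,v)=|E_G(u,v)|$. A cover of $G$ is a triple $\mathcal{H}=(L,H,M)$: $L$ assigns to each vertex a nonempty finite set, $H$ is a multigraph on $\bigcup_x L(x)$, $M$ assigns to each edge $e$ (with endpoints $u,v$) a matching $M(e)$ of $H$ whose edges go between $L(u)$ and $L(v)$, such that the $L(x)$ are pairwise disjoint, each $H[L(x)]$ is complete, $M(e_1)\cap M(e_2)=\emptyset$ for distinct edges, and for distinct $u,v$ the edges of $H$ between $L(u)$ and $L(v)$ are exactly $\bigcup_{e\in E_G(u,v)}M(e)$. It is a full $m$-fold cover if $|L(x)|=m$ for all $x$ and there are exactly $e_G(u,v)m$ edges of $H$ between $L(u)$ and $L(v)$ for all distinct $u,v$. An $\mathcal{H}$-coloring is an independent set of $H$ of size $|V(G)|$; $P_{DP}(G,\mathcal{H})$ is their number; $P_{DP}(G,m)$ is the minimum of $P_{DP}(G,\mathcal{H})$ over all full $m$-fold covers $\mathcal{H}$ of $G$. *)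

(* Defs.v *)
From mathcomp Require Import all_boot.
From mathcomp Require classical_sets.

Set Implicit Arguments.
Unset Strict Implicit.
Unset Printing Implicit Defensive.

(* The field [mg_loopless] says that every edge has two distinct endpoints;
   parallel edges are elements of [mg_edge] with the same [mg_ends]. *)
Record multigraph : Type := Multigraph {
  mg_vertex : finType;
  mg_edge : finType;
  mg_ends : mg_edge -> {set mg_vertex};
  mg_nonempty : 0 < #|mg_vertex|;
  mg_loopless : forall e, #|mg_ends e| = 2
}.

Definition edges (G : multigraph) (u v : mg_vertex G) : {set mg_edge G} :=
  [set e | mg_ends e == [set u; v]].

Definition edges_between (G : multigraph) (A B : {set mg_vertex G}) :
    {set mg_edge G} :=
  [set e | [exists a in A, exists b in B, mg_ends e == [set a; b]]].

Definition is_matching (G : multigraph) (D : {set mg_edge G}) : Prop :=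
  forall d1 d2, d1 \in D -> d2 \in D -> d1 != d2 ->
    [disjoint mg_ends d1 & mg_ends d2].

(* The subgraph induced on [A] is a complete (simple) graph. *)
Definition induces_complete (G : multigraph) (A : {set mg_vertex G}) : Prop :=
  forall a b, a \in A -> b \in A -> a != b -> #|edges a b| = 1.

Definition is_independent (G : multigraph) (I : {set mg_vertex G}) : bool :=
  [forall e : mg_edge G, ~~ (mg_ends e \subset I)].

Definition is_proper (G : multigraph) (m : nat)
    (f : {ffun mg_vertex G -> 'I_m}) : bool :=
  [forall u, forall v, (edges u v != set0) ==> (f u != f v)].

Definition P_chrom (G : multigraph) (m : nat) : nat :=
  #|[set f : {ffun mg_vertex G -> 'I_m} | is_proper f]|.

Record dp_cover (G : multigraph) : Type := Cover {
  cov_H : multigraph;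
  cov_L : mg_vertex G -> {set mg_vertex cov_H};
  cov_M : mg_edge G -> {set mg_edge cov_H};
  cov_L_nonempty : forall x, cov_L x != set0;
  cov_vertices : \bigcup_(x : mg_vertex G) cov_L x = [set: mg_vertex cov_H];
  cov_M_matching : forall e, is_matching (cov_M e);
  cov_M_between : forall u v e, e \in edges u v ->
    cov_M e \subset edges_between (cov_L u) (cov_L v);
  cov_L_disjoint : forall u v, u != v -> [disjoint cov_L u & cov_L v];
  cov_L_complete : forall x, induces_complete (cov_L x);
  cov_M_disjoint : forall e1 e2, e1 != e2 -> [disjoint cov_M e1 & cov_M e2];
  cov_edges : forall u v, u != v ->
    edges_between (cov_L u) (cov_L v) = \bigcup_(e in edges u v) cov_M e
}.

Definition is_full (G : multigraph) (m : nat) (C : dp_cover G) : Prop :=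
  (forall x, #|cov_L C x| = m) /\
  (forall u v, u != v ->
     #|edges_between (cov_L C u) (cov_L C v)| = #|edges u v| * m).

Definition cover_colorings (G : multigraph) (C : dp_cover G) :
    {set {set mg_vertex (cov_H C)}} :=
  [set I | is_independent I & #|I| == #|mg_vertex G|].

Definition P_DP_cover (G : multigraph) (C : dp_cover G) : nat :=
  #|cover_colorings C|.

Definition is_min_P_DP (G : multigraph) (m k : nat) : Prop :=
  (exists C : dp_cover G, is_full m C /\ P_DP_cover C = k) /\
  (forall C : dp_cover G, is_full m C -> k <= P_DP_cover C).

(* The minimum exists for every [m >= 1]; the default value [0] is only taken
   at [m = 0], where there is no full cover because the [L(x)] are nonempty. *)
Definition P_DP (G : multigraph) (m : nat) : nat :=
  classical_sets.xget 0 (is_min_P_DP G m).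

(* Main.v *)
(** A full [m]-fold cover has [m ^ n] transversals of the sets [L(x)].  Its
    colorings are the independent transversals, and each edge of [G] spoils at
    most [m ^ n.-1] transversals, since a matching edge makes the value at one
    endpoint determine the value at the other.  Hence every full cover has
    between [m ^ n - #|E| * m ^ n.-1] and [m ^ n] colorings.  The same bounds
    hold for the proper [m]-colorings, and the canonical cover shows that the
    minimum defining [P_DP] is attained. *)

Require Import Defs.
From HB Require Import structures.
From mathcomp Require Import all_boot all_order all_algebra.

Set Implicit Arguments.
Unset Strict Implicit.
Unset Printing Implicit Defensive.

(** * Counting functions in a product of finite sets *)

Lemma card_bigcup_le (I T : finType) (P : pred I) (F : I -> {set T}) :
  #|\bigcup_(i | P i) F i| <= \sum_(i | P i) #|F i|.
Proof.
elim/big_rec2: _ => [|i k A _ IH]; first by rewrite cards0.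
by apply: leq_trans (leq_card_setU _ _).1 _; rewrite leq_add2l.
Qed.

Lemma card_family_const (V T : finType) (F : V -> {set T}) (m : nat) :
  (forall x, #|F x| = m) -> #|family F| = m ^ #|V|.
Proof.
move=> cardF; rewrite card_family foldrE big_map.
rewrite (eq_bigr (fun=> m)) => [|x _]; last by rewrite cardF.
by rewrite big_enum prod_nat_const; congr (_ ^ _); apply: eq_card.
Qed.

(** Overwriting the value at [w] by a fixed [f0 w] is injective on [B], and the image lies in a
    product whose factor at [w] is a singleton. *)
Lemma card_family_determined (V T : finType) (F : V -> {set T}) (m : nat)
    (B : {set {ffun V -> T}}) (w : V) :
  (forall x, #|F x| = m) -> {subset B <= family F} ->
  (forall f g, f \in B -> g \in B -> (forall x, x != w -> f x = g x) -> f = g) ->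
  #|B| <= m ^ #|V|.-1.
Proof.
move=> cardF BF detB; have [->|[f0 _]] := set_0Vmem B; first by rewrite cards0.
pose F' x := if x == w then [set f0 w] else F x.
pose r (f : {ffun V -> T}) := [ffun x => if x == w then f0 w else f x].
have r_inj : {in B &, injective r}.
  move=> f g fB gB /ffunP rfg; apply: detB => // x /negPf xw.
  by have := rfg x; rewrite !ffunE xw.
rewrite -(card_in_imset r_inj).
have -> : m ^ #|V|.-1 = #|family F'|.
  rewrite card_family foldrE big_map big_enum (bigD1 w) //= /F' eqxx cards1 mul1n.
  rewrite (eq_bigr (fun=> m)) => [|x /negPf ->]; last by rewrite cardF.
  rewrite prod_nat_const; congr (_ ^ _).
  by rewrite (cardD1 w) /=; apply: eq_card => x; rewrite !inE andbT.
apply/subset_leq_card/subsetP => _ /imsetP[f /BF /familyP fF ->].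
apply/familyP => x; rewrite ffunE /F'; case: eqP => // _.
by rewrite inE.
Qed.

(** Union bound over bad events [B e], each of which lets the values away from [w e] determine the
    function. The additive form avoids truncated subtraction. *)
Lemma card_family_avoid (V E T : finType) (F : V -> {set T}) (m : nat)
    (B : E -> pred {ffun V -> T}) (w : E -> V) :
  (forall x, #|F x| = m) ->
  (forall e f g, f \in family F -> g \in family F -> B e f -> B e g ->
    (forall x, x != w e -> f x = g x) -> f = g) ->
  m ^ #|V| <= #|[set f in family F | [forall e, ~~ B e f]]|
              + #|E| * m ^ #|V|.-1.
Proof.
move=> cardF detB; rewrite -(card_family_const cardF).
pose Bs e := [set f in family F | B e f].
have sub : family F \subset [set f in family F | [forall e, ~~ B e f]]
                            :|: \bigcup_e Bs e.
  apply/subsetP => f fF; rewrite in_setU in_set fF /=.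
  case: forallP => //= /forallP; rewrite negb_forall => /existsP[e].
  by rewrite negbK => Bf; apply/bigcupP; exists e => //; rewrite in_set fF.
apply: leq_trans (subset_leq_card sub) _.
apply: leq_trans (leq_card_setU _ _).1 _; rewrite leq_add2l.
apply: leq_trans (card_bigcup_le _ _) _.
rewrite -sum_nat_const; apply: leq_sum => e _.
apply: (card_family_determined (w := w e) cardF) => [f|f g].
  by rewrite in_set => /andP[].
by rewrite !in_set => /andP[fF Bf] /andP[gF Bg]; apply: detB.
Qed.

(** * Bounds on the number of proper colorings *)

Lemma edge_endsP (G : multigraph) (e : mg_edge G) :
  exists u v, u != v /\ e \in edges u v.
Proof.
have /eqP/cards2P[u [v [uv eE]]] := mg_loopless e.
by exists u, v; split=> //; rewrite inE eE.
Qed.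

Lemma P_chrom_le (G : multigraph) (m : nat) : P_chrom G m <= m ^ #|mg_vertex G|.
Proof. by apply: leq_trans (max_card _) _; rewrite card_ffun card_ord. Qed.

Lemma P_chrom_ge (G : multigraph) (m : nat) :
  m ^ #|mg_vertex G| <=
    P_chrom G m + #|mg_edge G| * m ^ #|mg_vertex G|.-1.
Proof.
have /fin_all_exists[w wP] : forall e : mg_edge G,
    exists w, exists2 u, w != u & mg_ends e = [set w; u].
  move=> e; have [u [v [uv]]] := edge_endsP e.
  by rewrite inE => /eqP eE; exists u, v.
(* The bad event of [e] is that [f] is constant on its ends, so the color of [w e] is that of the
   other end. *)
pose B e (f : {ffun mg_vertex G -> 'I_m}) :=
  [forall x in mg_ends e, forall y in mg_ends e, f x == f y].
have cardF (x : mg_vertex G) : #|[set: 'I_m]| = m by rewrite cardsT card_ord.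
apply: leq_trans (card_family_avoid (B := B) (w := w) cardF _) _.
  move=> e f g _ _ /forall_inP Bf /forall_inP Bg fg; apply/ffunP => x.
  have [->|] := eqVneq x (w e); last exact: fg.
  have [u wu eE] := wP e.
  have wE : w e \in mg_ends e by rewrite eE !inE eqxx.
  have uE : u \in mg_ends e by rewrite eE !inE eqxx orbT.
  move: (Bf _ wE) (Bg _ wE) => /forall_inP/(_ _ uE)/eqP-> /forall_inP/(_ _ uE)/eqP->.
  by apply: fg; rewrite eq_sym.
rewrite leq_add2r; apply/subset_leq_card/subsetP => f.
rewrite !in_set => /andP[_ /forallP noB].
apply/forallP => u; apply/forallP => v; apply/implyP => /set0Pn[e].
rewrite inE => /eqP eE; apply: contra (noB e) => /eqP fuv.
apply/forall_inP => x; rewrite eE !inE => xE.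
apply/forall_inP => y; rewrite !inE => yE.
by case/orP: xE => /eqP->; case/orP: yE => /eqP->; rewrite ?fuv.
Qed.

(** * Colorings of a cover as independent transversals *)

Section Transversals.

Variables (G : multigraph) (C : dp_cover G).
Notation V := (mg_vertex G).
Notation H := (cov_H C).
Notation L := (@cov_L G C).
Implicit Types f g : {ffun V -> mg_vertex H}.

Lemma cov_L_inj (x y : V) (a : mg_vertex H) : a \in L x -> a \in L y -> x = y.
Proof.
move=> ax ay; apply/eqP; apply: contraT => /(@cov_L_disjoint _ C).
by move/pred0P/(_ a); rewrite /= ax ay.
Qed.

Lemma transversal_val_inj f : f \in family L -> injective f.
Proof.
move=> /familyP fL x y fxy; apply: (@cov_L_inj x y (f x)); first exact: fL.
by rewrite fxy; apply: fL.
Qed.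

(** Disjointness of the sets [L x] reveals which vertex each element of the image comes from, so
    colorings, which are sets, can be counted as functions. *)
Lemma transversal_image_inj :
  {in family L &, injective (fun f => f @: [set: V])}.
Proof.
move=> f g /familyP fL /familyP gL fg; apply/ffunP => x.
have : f x \in f @: [set: V] by apply: imset_f; rewrite inE.
rewrite fg => /imsetP[y _ fgy]; rewrite fgy; congr (g _).
by apply/esym/(@cov_L_inj _ _ (f x)); [apply: fL | rewrite fgy; apply: gL].
Qed.

(* Completeness of [L(x)] leaves at most one vertex of [I] in each [L(x)];
   counting then gives exactly one. *)
Lemma coloring_transversal (I : {set mg_vertex H}) :
  I \in cover_colorings C -> exists2 f, f \in family L & I = f @: [set: V].
Proof.
rewrite inE => /andP[/forallP indI /eqP cardI].
have le1 x : #|I :&: L x| <= 1.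
  apply/card_le1_eqP => a b; rewrite !inE => /andP[aI aL] /andP[bI bL].
  apply/eqP; apply: contraT => ab.
  have /eqP/cards1P[d /setP/(_ d)] := cov_L_complete bL aL ab.
  rewrite !inE eqxx => /eqP dE.
  by have := indI d; rewrite dE subUset !sub1set aI bI.
(* Double counting: the sets [L x] partition the vertices of [H], so each element of [I] is counted
   exactly once. *)
have sumI : \sum_x #|I :&: L x| = \sum_(x : V) 1.
  rewrite sum1_card -[RHS]cardI -[RHS]sum1_card.
  under eq_bigr => x _ do rewrite -sum1_card.
  rewrite (exchange_big_dep (mem I)) /=; last by move=> x a _; rewrite inE => /andP[].
  apply: eq_bigr => a aI.
  have : a \in [set: mg_vertex H] by rewrite inE.
  rewrite -(cov_vertices C) => /bigcupP[x _ ax].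
  rewrite (bigD1 x) ?inE ?aI //= big1 // => y /andP[].
  by rewrite inE aI => /(cov_L_inj ax) -> /eqP.
(* If one term were zero, the remaining terms, each at most 1, would have to add up to one more than
   their number. *)
have eq1 x : #|I :&: L x| = 1.
  apply/eqP; rewrite eqn_leq le1 /= lt0n; apply/eqP => I0.
  move: sumI; rewrite (bigD1 x) // [RHS](bigD1 x) //= I0 add0n => eqs.
  have : \sum_(i | i != x) #|I :&: L i| <= \sum_(i : V | i != x) 1.
    by apply: leq_sum.
  by rewrite eqs ltnn.
have /fin_all_exists[h hP] : forall x, exists a, a \in I :&: L x.
  by move=> x; apply/set0Pn; rewrite -card_gt0 eq1.
have hF : [ffun x => h x] \in family L.
  by apply/familyP => x; rewrite ffunE; have := hP x; rewrite inE => /andP[].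
exists [ffun x => h x] => //; apply/esym/eqP; rewrite eqEcard.
rewrite card_imset ?cardsT ?cardI ?leqnn ?andbT; last exact: transversal_val_inj.
apply/subsetP => _ /imsetP[x _ ->]; rewrite ffunE.
by have := hP x; rewrite inE => /andP[].
Qed.

Lemma P_DP_cover_le (m : nat) :
  (forall x, #|L x| = m) -> P_DP_cover C <= m ^ #|V|.
Proof.
move=> /card_family_const <-.
rewrite -[leqRHS](card_in_imset transversal_image_inj).
apply/subset_leq_card/subsetP => I /coloring_transversal[f fF ->].
exact: imset_f.
Qed.

(** Two edges of a matching that meet at [a] coincide, and looplessness makes the end other than [a]
    unique. *)
Lemma matching_partner_inj (e : mg_edge G) (d1 d2 : mg_edge H) (a b c : mg_vertex H) :
  d1 \in cov_M C e -> d2 \in cov_M C e ->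
  mg_ends d1 = [set a; b] -> mg_ends d2 = [set a; c] -> b = c.
Proof.
move=> d1e d2e E1 E2; have d12 : d1 = d2.
  apply/eqP; apply: contraT => /(cov_M_matching d1e d2e)/pred0P/(_ a).
  by rewrite /= E1 E2 !inE eqxx.
have := mg_loopless d2; have := mg_loopless d1.
rewrite {1}E1 {1}E2 !cards2; case: (eqVneq a b) => // ab _ _.
have : b \in mg_ends d2 by rewrite -d12 E1 !inE eqxx orbT.
by rewrite E2 !inE eq_sym (negPf ab) => /eqP.
Qed.

Lemma P_DP_cover_ge (m : nat) :
  (forall x, #|L x| = m) ->
  m ^ #|V| <= P_DP_cover C + #|mg_edge G| * m ^ #|V|.-1.
Proof.
move=> cardL.
have /fin_all_exists[uv uvP] : forall e : mg_edge G,
    exists p : V * V, p.1 != p.2 /\ e \in edges p.1 p.2.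
  by move=> e; have [u [v uvE]] := edge_endsP e; exists (u, v).
(* The bad event of [e] is that an edge of its matching joins the two values of [f] at the ends of
   [e]. *)
pose B e f :=
  [exists d in cov_M C e, mg_ends d == [set f (uv e).1; f (uv e).2]].
apply: leq_trans (card_family_avoid (B := B) (w := fun e => (uv e).2) cardL _) _.
  move=> e f g _ _ /exists_inP[d1 d1e /eqP E1] /exists_inP[d2 d2e /eqP E2] fg.
  apply/ffunP => x; have [->|] := eqVneq x (uv e).2; last exact: fg.
  (* Agreement at [(uv e).1] makes the two matching edges share an end. *)
  rewrite -fg ?(uvP e).1 // in E2.
  exact: matching_partner_inj d1e d2e E1 E2.
rewrite leq_add2r.
have inj : {in [set f in family L | [forall e, ~~ B e f]] &,
             injective (fun f => f @: [set: V])}.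
  by move=> f g; rewrite !in_set => /andP[fF _] /andP[gF _]; apply: transversal_image_inj.
rewrite -(card_in_imset inj).
apply/subset_leq_card/subsetP => _ /imsetP[f + ->].
rewrite !in_set => /andP[fF /forallP noB].
have finj := transversal_val_inj fF.
rewrite card_imset // cardsT eqxx andbT.
apply/forallP => d; apply/negP => dI.
have [a [b [ab]]] := edge_endsP d; rewrite inE => /eqP dE.
move: dI; rewrite dE subUset !sub1set => /andP[/imsetP[x _ ax] /imsetP[y _ by_]].
(* Since [x] and [y] differ, [d] runs between two different sets [L x] and [L y], so [cov_edges]
   puts it in the matching of some [e]. *)
subst a b; have xy : x != y by apply: contraNneq ab => ->.
have /familyP fL := fF.
have : d \in edges_between (L x) (L y).
  rewrite inE; apply/exists_inP; exists (f x); first exact: fL.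
  by apply/exists_inP; exists (f y); [apply: fL | rewrite dE].
rewrite cov_edges // => /bigcupP[e]; rewrite inE => /eqP eE de.
move/negP: (noB e); apply; apply/exists_inP; exists d => //.
have [uvne] := uvP e; rewrite inE => /eqP eE'.
(* Passing to the image of [mg_ends e] removes the dependence on the order in which [uv] lists the
   ends. *)
have -> : [set f (uv e).1; f (uv e).2] = f @: mg_ends e.
  by rewrite eE' imsetU1 imset_set1.
by rewrite dE eE imsetU1 imset_set1.
Qed.

End Transversals.

(** * The canonical cover, whose matchings join equal colors *)

Section CanonicalCover.

Variables (G : multigraph) (k : nat).
Notation m := k.+1.
Notation V := (mg_vertex G).
Notation E := (mg_edge G).

Definition canon_vertex : finType := (V * 'I_m)%type.
(* The left summand carries the perfect matchings [(u, i) -- (v, i)], the right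
   one the edges of the cliques [L(x)]. *)
Definition canon_edge : finType :=
  ((E * 'I_m) + {p : V * {set 'I_m} | #|p.2| == 2})%type.

Definition canon_ends (d : canon_edge) : {set canon_vertex} :=
  match d with
  | inl p => setX (mg_ends p.1) [set p.2]
  | inr q => setX [set (val q).1] (val q).2
  end.

Lemma canon_nonempty : 0 < #|canon_vertex|.
Proof. by rewrite card_prod card_ord muln_gt0 mg_nonempty. Qed.

Lemma canon_loopless d : #|canon_ends d| = 2.
Proof.
case: d => [[e i]|[[x S] /= /eqP cS]] /=; rewrite cardsX cards1.
  by rewrite mg_loopless.
by rewrite cS.
Qed.

Definition canon_graph : multigraph := Multigraph canon_nonempty canon_loopless.

Definition canon_L (x : V) : {set mg_vertex canon_graph} := setX [set x] setT.
Definition canon_M (e : E) : {set mg_edge canon_graph} :=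
  [set inl (e, i) | i : 'I_m].

Lemma canon_L_nonempty x : canon_L x != set0.
Proof. by apply/set0Pn; exists (x, ord0); rewrite !inE eqxx. Qed.

Lemma canon_vertices : \bigcup_x canon_L x = [set: mg_vertex canon_graph].
Proof.
apply/setP => -[x i]; rewrite inE; apply/bigcupP; exists x => //.
by rewrite !inE eqxx.
Qed.

Lemma canon_M_matching e : is_matching (canon_M e).
Proof.
move=> _ _ /imsetP[i _ ->] /imsetP[j _ ->] ij.
apply/pred0P => -[x l] /=; rewrite !inE /=; apply/negP.
case/andP=> /andP[_ /eqP li] /andP[_ /eqP lj].
by move: ij; rewrite -li -lj eqxx.
Qed.

Lemma canon_edges u v : u != v ->
  edges_between (canon_L u) (canon_L v) = \bigcup_(e in edges u v) canon_M e.
Proof.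
move=> uv; apply/setP => d; rewrite inE; apply/exists_inP/bigcupP.
  case=> -[u' i]; rewrite !inE andbT /= => /eqP-> /exists_inP[[v' j]].
  rewrite !inE andbT /= => /eqP-> /eqP dE.
  have ui : (u, i) \in canon_ends d by rewrite dE !inE eqxx.
  have vj : (v, j) \in canon_ends d by rewrite dE !inE eqxx orbT.
  (* A clique edge has both ends over one vertex, which [u != v] excludes; a matching edge lies over
     an [e] whose two ends must be [u] and [v]. *)
  case: d dE ui vj => [[e l]|[[x S] cS]] /= dE; rewrite !inE /=.
    move=> /andP[ue /eqP il] /andP[ve /eqP jl].
    exists e; last by apply/imsetP; exists l.
    rewrite inE eq_sym eqEcard subUset !sub1set ue ve /=.
    by rewrite mg_loopless cards2 uv.
  by move=> /andP[/eqP ux _] /andP[/eqP vx _]; rewrite ux vx eqxx in uv.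
case=> e; rewrite inE => /eqP eE /imsetP[i _ ->].
exists (u, i); first by rewrite !inE eqxx.
apply/exists_inP; exists (v, i); first by rewrite !inE eqxx.
rewrite /= eE; apply/eqP/setP => -[x l].
by rewrite !inE !xpair_eqE /= andb_orl.
Qed.

Lemma canon_M_between u v e : e \in edges u v ->
  canon_M e \subset edges_between (canon_L u) (canon_L v).
Proof.
move=> euv; rewrite canon_edges; first exact: (bigcup_sup e).
move: euv; rewrite inE => /eqP eE; have := mg_loopless e.
by rewrite eE cards2; case: eqP.
Qed.

Lemma canon_L_disjoint u v : u != v -> [disjoint canon_L u & canon_L v].
Proof.
move=> uv; apply/pred0P => -[x i]; rewrite /= !inE !andbT; apply/negP.
by move=> /andP[/eqP xu /eqP xv]; rewrite -xu -xv eqxx in uv.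
Qed.

Lemma canon_L_complete x : induces_complete (canon_L x).
Proof.
move=> [y i] [z j]; rewrite !inE !andbT /= => /eqP-> /eqP-> xij.
have ij : i != j by apply: contraNneq xij => ->.
have cS : #|(x, [set i; j]).2| == 2 by rewrite /= cards2 ij.
apply/eqP/cards1P.
exists (inr (exist (fun p : V * {set 'I_m} => #|p.2| == 2) (x, [set i; j]) cS)).
apply/setP => d; rewrite !inE; apply/eqP/eqP => [dE|->]; last first.
  apply/setP => -[y' l]; rewrite !inE !xpair_eqE /=.
  by case: (y' == x).
have xi : (x, i) \in canon_ends d by rewrite [canon_ends d]dE !inE eqxx.
have xj : (x, j) \in canon_ends d by rewrite [canon_ends d]dE !inE eqxx orbT.
(* A matching edge has ends of equal color, which [i != j] excludes; a clique edge is indexed by an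
   unordered pair, which must be that of [i] and [j]. *)
case: d dE xi xj => [[e l]|[[x' S] cS']] /= dE; rewrite !inE /=.
  by move=> /andP[_ /eqP il] /andP[_ /eqP jl]; rewrite il jl eqxx in ij.
move=> /andP[/eqP xx' iS] /andP[_ jS]; congr inr; apply: val_inj => /=.
rewrite -xx'; congr pair; apply/esym/eqP; rewrite eqEcard subUset !sub1set iS jS.
by rewrite (eqP cS') cards2 ij.
Qed.

Lemma canon_M_disjoint e1 e2 : e1 != e2 -> [disjoint canon_M e1 & canon_M e2].
Proof.
move=> e12; apply/pred0P => d /=; apply/negP.
by case/andP=> /imsetP[i _ ->] /imsetP[j _ [eE _]]; rewrite eE eqxx in e12.
Qed.

Definition canon_cover : dp_cover G :=
  Cover canon_L_nonempty canon_vertices canon_M_matching canon_M_between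
    canon_L_disjoint canon_L_complete canon_M_disjoint canon_edges.

Lemma canon_cover_full : is_full m canon_cover.
Proof.
split=> [x|u v uv] /=; first by rewrite cardsX cards1 cardsT card_ord mul1n.
rewrite canon_edges //.
(* The union is an injective image of a product, which gives the count at once. *)
have -> : \bigcup_(e in edges u v) canon_M e =
          [set (inl p : mg_edge canon_graph) | p in setX (edges u v) [set: 'I_m]].
  apply/setP => d; apply/bigcupP/imsetP => [[e eE /imsetP[i _ ->]]|[[e i]]].
    by exists (e, i) => //; rewrite inE eE inE.
  by rewrite inE => /andP[eE _] ->; exists e => //; apply: imset_f.
by rewrite card_imset ?cardsX ?cardsT ?card_ord // => p q [].
Qed.

End CanonicalCover.

(** * Attainment of the minimum and the asymptotic estimate *)

Lemma P_DP_attained (G : multigraph) (m : nat) : 0 < m ->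
  exists2 C : dp_cover G, is_full m C & P_DP_cover C = P_DP G m.
Proof.
case: m => // k _.
pose Q j := exists C : dp_cover G, is_full k.+1 C /\ P_DP_cover C = j.
have [j [Qj jmin]] : exists j, is_min_P_DP G k.+1 j.
  (* The canonical cover supplies a value; [asbool] makes the predicate boolean, so that a least
     value can be extracted. *)
  have exQ : exists j, boolp.asbool (Q j).
    exists (P_DP_cover (canon_cover G k)); apply/boolp.asboolP.
    by exists (canon_cover G k); split=> //; apply: canon_cover_full.
  case: (ex_minnP exQ) => j /boolp.asboolP Qj jmin; exists j; split=> // C fC.
  by apply: jmin; apply/boolp.asboolP; exists C.
(* Once a minimum exists, [xget] returns one rather than its default 0. *)
have [] : is_min_P_DP G k.+1 (P_DP G k.+1).
  by apply: (classical_sets.xgetPex 0); exists j.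
by case=> C [fC PC] _; exists C.
Qed.

(** Both numbers lie between [m ^ n - d] and [m ^ n], with [n] the number of vertices. Both
    directions serve to bound the absolute value of the difference. *)
Lemma P_chrom_P_DP_close (G : multigraph) (m : nat) : 0 < m ->
  let d := #|mg_edge G| * m ^ #|mg_vertex G|.-1 in
  P_chrom G m <= P_DP G m + d /\ P_DP G m <= P_chrom G m + d.
Proof.
move=> /(P_DP_attained G)[C [cardL _] <-] d; split.
  exact: leq_trans (P_chrom_le G m) (P_DP_cover_ge cardL).
exact: leq_trans (P_DP_cover_le cardL) (P_chrom_ge G m).
Qed.

From mathcomp Require Import all_classical all_reals all_analysis.
Import Order.TTheory GRing.Theory Num.Theory.
Import numFieldNormedType.Exports.

Local Open Scope classical_set_scope.
Local Open Scope ring_scope.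

Theorem theorem18 (R : realType) (G : multigraph) (n : nat)
    (hn : #|mg_vertex G| = n) :
  (fun m : nat => (P_chrom G m)%:R - (P_DP G m)%:R : R) =O_\oo
  (fun m : nat => m%:R ^+ (n - 1) : R).
Proof.
(* The added 1 keeps the constant positive when [G] has no edges. *)
apply/eqO_exP; exists (#|mg_edge G|%:R + 1); first by rewrite ltr_wpDl.
(* The bound holds from [m = 1] on, where the minimum is attained. *)
exists 1%N => //= m m_gt0.
have [le1 le2] := @P_chrom_P_DP_close G m m_gt0.
rewrite hn in le1 le2.
rewrite normrX normr_nat -natrX natr1 -natrM subn1 ler_distl.
rewrite lerBlDr -!natrD !ler_nat mulSn.
by rewrite (leq_trans le1) ?(leq_trans le2) ?leq_add2l ?leq_addl.
Qed.
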